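(* Let $p$ be a prime number and let $f\in\mathbb{Q}_{\rho}[[z]]$ be a $p$-adic analytic function with radius of convergence $\rho\in(0,\infty]$. If $\alpha\in S_f$ is such that $[\mathbb{Q}_p(\alpha):\mathbb{Q}_p]>1$, then $S_f$ contains every $\alpha'\in\overline{\mathbb{Q}}$ which is a $\mathbb{Q}_p$-conjugate of $\alpha$.
   Context: $p$ is a fixed prime; $\mathbb{C}_p$ is the completion of an algebraic closure of $\mathbb{Q}_p$, with absolute value $|\cdot|$ extending the $p$-adic absolute value normalized by $|p|=p^{-1}$. $\overline{\mathbb{Q}}\subset\mathbb{C}_p$ denotes the set of elements of $\mathbb{C}_p$ algebraic over $\mathbb{Q}$. $B(0,\rho)=\{z\in\mathbb{C}_p:|z|<\rho\}$, with $B(0,\infty)=\mathbb{C}_p$. $\mathbb{Q}_{\rho}[[z]]$ is the set of all power series $f(z)=\sum_{n\ge 0}a_nz^n$ with all $a_n\in\mathbb{Q}$ (rational coefficients) and with radius of convergence $\rho$ in $\mathbb{C}_p$; such an $f$ is regarded as an analytic function $B(0,\rho)\to\mathbb{C}_p$. Its exceptional set is $S_f=\{\alpha\in B(0,\rho)\cap\overline{\mathbb{Q}}: f(\alpha)\in\overline{\mathbb{Q}}\}$. $\alpha'$ is a $\mathbb{Q}_p$-conjugate of $\alpha$ if $\alpha'$ is a root of the minimal polynomial of $\alpha$ over $\mathbb{Q}_p$. *)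

(* Defs.v *)
From mathcomp Require Import all_boot all_order all_algebra.
From mathcomp Require Import all_classical all_reals all_analysis.
Import Order.TTheory GRing.Theory Num.Theory.
Import numFieldNormedType.Exports.

Set Implicit Arguments.
Unset Strict Implicit.
Unset Printing Implicit Defensive.

Local Open Scope classical_set_scope.
Local Open Scope ring_scope.

Definition padic_abs (R : realType) (p : nat) (x : rat) : R :=
  if x == 0 then 0
  else p%:R ^ ((logn p `|denq x|)%:Z - (logn p `|numq x|)%:Z).

Definition absolute_value (R : realType) (K : fieldType) (v : K -> R) : Prop :=
  [/\ forall x, 0 <= v x,
      forall x, v x = 0 <-> x = 0,
      forall x y, v (x * y) = v x * v y
    & forall x y, v (x + y) <= Num.max (v x) (v y)].

Definition abs_cvg (R : realType) (K : fieldType) (v : K -> R)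
    (u : nat -> K) (l : K) : Prop :=
  v (u n - l) @[n --> \oo] --> (0 : R).

Definition abs_cauchy (R : realType) (K : fieldType) (v : K -> R)
    (u : nat -> K) : Prop :=
  forall e : R, 0 < e ->
    exists N, forall m n, (N <= m)%N -> (N <= n)%N -> v (u m - u n) < e.

Definition is_completion (R : realType) (F K : fieldType)
    (vF : F -> R) (vK : K -> R) (i : F -> K) : Prop :=
  [/\ absolute_value vK,
      forall x, vK (i x) = vF x,
      forall u, abs_cauchy vK u -> exists l, abs_cvg vK u l
    & forall y (e : R), 0 < e -> exists x, vK (y - i x) < e].

(* Cp is any completion of any algebraic closure of any completion of rat, each
   stage carrying its absolute value; such a tower is unique up to isometric
   isomorphism. The value group of Qp is normalized by |p| = 1/p through
   padic_abs. *)
Record padic_complex (R : realType) (p : nat) := PadicComplex {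
  Qp : fieldType;
  Qp_abs : Qp -> R;
  Qp_of_rat : {rmorphism rat -> Qp};
  Qp_completion : is_completion (padic_abs R p) Qp_abs Qp_of_rat;
  Qpbar : closedFieldType;
  Qpbar_abs : Qpbar -> R;
  Qpbar_of_Qp : {rmorphism Qp -> Qpbar};
  Qpbar_algebraic : forall x : Qpbar, algebraicOver Qpbar_of_Qp x;
  Qpbar_absolute_value : absolute_value Qpbar_abs;
  Qpbar_abs_extends : forall x, Qpbar_abs (Qpbar_of_Qp x) = Qp_abs x;
  Cp :> fieldType;
  Cp_abs : Cp -> R;
  Cp_of_Qpbar : {rmorphism Qpbar -> Cp};
  Cp_completion : is_completion Qpbar_abs Cp_abs Cp_of_Qpbar
}.

(* The subfield F(z) of K, for F embedded in K by i. *)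
Definition adjoin (F K : fieldType) (i : F -> K) (z : K) : set K :=
  [set x | forall S : {pred K}, divring_closed S ->
             (forall c, i c \in S) -> z \in S -> x \in S].

(* b is a basis of S over F, for F embedded in K by i. *)
Definition is_basis (F K : fieldType) (i : F -> K) (S : set K)
    (d : nat) (b : 'I_d -> K) : Prop :=
  [/\ forall j, S (b j),
      forall c : 'I_d -> F, \sum_(j < d) i (c j) * b j = 0 ->
        forall j, c j = 0
    & forall x, S x -> exists c : 'I_d -> F, x = \sum_(j < d) i (c j) * b j].

Definition ext_degree (F K : fieldType) (i : F -> K) (S : set K) (d : nat) :
    Prop :=
  exists b : 'I_d -> K, is_basis i S b.

Definition is_min_poly (F K : fieldType) (i : {rmorphism F -> K}) (z : K)
    (m : {poly F}) : Prop :=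
  [/\ m \is monic, root (map_poly i m) z
    & forall q : {poly F}, q != 0 -> root (map_poly i q) z ->
        (size m <= size q)%N].

Definition conjugate_over (F K : fieldType) (i : {rmorphism F -> K})
    (z z' : K) : Prop :=
  exists2 m : {poly F}, is_min_poly i z m & root (map_poly i m) z'.

Section PadicSeries.
Variables (R : realType) (p : nat) (C : padic_complex R p).

Definition Cp_of_Qp : {rmorphism Qp C -> Cp C} :=
  (@Cp_of_Qpbar R p C \o @Qpbar_of_Qp R p C)%FUN.

Definition Cp_of_rat : {rmorphism rat -> Cp C} :=
  (Cp_of_Qp \o @Qp_of_rat R p C)%FUN.

Definition Qbar : set (Cp C) := [set z | algebraicOver Cp_of_rat z].

Definition ball0 (rho : \bar R) : set (Cp C) :=
  [set z | ((Cp_abs z)%:E < rho)%E].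

Definition pseries_cvg (a : nat -> rat) (z w : Cp C) : Prop :=
  abs_cvg (@Cp_abs R p C) (series (fun n => Cp_of_rat (a n) * z ^+ n)) w.

(* Junk value 0 where the series diverges. *)
Definition pseries (a : nat -> rat) (z : Cp C) : Cp C :=
  xget 0 [set w | pseries_cvg a z w].

Definition radius_of_convergence (a : nat -> rat) : \bar R :=
  ereal_sup [set (Cp_abs z)%:E | z in [set z | exists w, pseries_cvg a z w]].

Definition exceptional_set (a : nat -> rat) (rho : \bar R) : set (Cp C) :=
  [set z | [/\ ball0 rho z, Qbar z & Qbar (pseries a z)]].

End PadicSeries.

(* Main.v *)
Require Import Defs.
From mathcomp Require Import all_boot all_order all_algebra.
From mathcomp Require Import all_classical all_reals all_analysis.
Import Order.TTheory GRing.Theory Num.Theory.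
Import numFieldNormedType.Exports.

Local Open Scope ring_scope.

(** Everything rests on one inequality. Let [m] be the minimal polynomial of
    [alpha] over Qp, and [alpha'] another root of [m]. Then there is a constant
    [C] with

      |P(alpha')| <= C |P(alpha)|   for all P in Qp[X]

    ([conjugate_abs_horner_le]). Indeed [P] may be replaced by its remainder
    modulo [m]; its coefficients are then the coordinates of [P(alpha)] in the
    basis of powers of [alpha], and on a finite-dimensional space over a
    complete field the coordinates are bounded by the norm
    ([free_coord_bound]). Thus the isomorphism Qp(alpha) -> Qp(alpha') sending
    [alpha] to [alpha'] is continuous, and no automorphism of the algebraic
    closure is needed.

    The inequality has three consequences. Applied to the powers of X, it gives
    |alpha'|^n <= C |alpha|^n for all n, hence |alpha'| <= |alpha|, so that
    [alpha'] lies in the disc of convergence ([conjugate_abs_le]). Applied to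
    differences P_n - Q, it transports the convergence of P_n(alpha) to
    Q(alpha) into that of P_n(alpha') to Q(alpha') ([conjugate_horner_cvg]).
    Applied to P with P(alpha) = 0, it shows that algebraic relations pass from
    [alpha] to [alpha'] ([conjugate_horner_root]).

    Now the partial sums of f are polynomials P_n with coefficients in Qp, and
    f(alpha) = lim P_n(alpha) lies in Qp(alpha), because a finite-dimensional
    subspace is closed ([span_closed], [adjoin_closed]). So f(alpha) = Q(alpha)
    for some Q in Qp[X], whence f(alpha') = Q(alpha'). Finally, if a nonzero
    polynomial q with rational coefficients annihilates Q(alpha), then q o Q
    vanishes at [alpha], hence at [alpha'], and q annihilates f(alpha'). *)

(** * Absolute values *)

Lemma geometric_lt {R : realType} (r a e : R) : 0 <= r -> r < 1 -> 0 < e ->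
  exists N, forall n, (N <= n)%N -> a * r ^+ n < e.
Proof.
move=> r_ge0 r_lt1 e_gt0.
have /cvgrPdist_lt/(_ e e_gt0)[N _ ltN] :
    (geometric a r n @[n --> \oo] --> (0 : R))%classic.
  by apply: cvg_geometric; rewrite ger0_norm.
exists N => n /ltN; rewrite /= sub0r normrN; apply: le_lt_trans.
exact: ler_norm.
Qed.

Section AbsoluteValue.
Context {R : realType} {K : fieldType} {v : K -> R}.
Hypothesis v_abs : absolute_value v.

Lemma abs_ge0 x : 0 <= v x.
Proof. by case: v_abs. Qed.

Lemma abs_eq0 x : v x = 0 -> x = 0.
Proof. by case: v_abs => _ /(_ x)[]. Qed.

Lemma abs0 : v 0 = 0.
Proof. by case: v_abs => _ /(_ 0)[_ ->]. Qed.

Lemma absM : {morph v : x y / x * y}.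
Proof. by case: v_abs. Qed.

Lemma abs1 : v 1 = 1.
Proof.
have v1_neq0 : v 1 != 0 by apply/eqP => /abs_eq0/eqP; rewrite oner_eq0.
by apply: (mulfI v1_neq0); rewrite -absM !mulr1.
Qed.

Lemma absX x n : v (x ^+ n) = v x ^+ n.
Proof. by elim: n => [|n IHn]; rewrite ?abs1 // !exprS absM IHn. Qed.

Lemma absN x : v (- x) = v x.
Proof.
suff vN1 : v (-1) = 1 by rewrite -mulN1r absM vN1 mul1r.
apply/eqP; rewrite -(@eqrXn2 _ 2) ?abs_ge0 //.
by rewrite -absX sqrrN !expr1n abs1.
Qed.

Lemma abs_distC x y : v (x - y) = v (y - x).
Proof. by rewrite -absN opprB. Qed.

Lemma abs_add_lt x y e : v x < e -> v y < e -> v (x + y) < e.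
Proof.
move=> ltxe ltye; have [_ _ _ /(_ x y) le_max] := v_abs.
by apply: le_lt_trans le_max _; rewrite gt_max ltxe.
Qed.

Lemma abs_sum_lt n (F : nat -> K) e : 0 < e ->
  (forall j, (j < n)%N -> v (F j) < e) -> v (\sum_(j < n) F j) < e.
Proof.
move=> e_gt0 ltFe; apply: (big_ind (fun x => v x < e)) => [|x y|j _].
- by rewrite abs0.
- exact: abs_add_lt.
- exact: ltFe.
Qed.

Lemma abs_add_le x y : v (x + y) <= v x + v y.
Proof.
have [_ _ _ /(_ x y) le_max] := v_abs.
by apply: le_trans le_max _; rewrite ge_max lerDl lerDr !abs_ge0.
Qed.

Lemma abs_sum_le n (F : nat -> K) :
  v (\sum_(j < n) F j) <= \sum_(j < n) v (F j).
Proof.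
apply: (big_ind2 (fun x y => v x <= y)) => [|x1 y1 x2 y2 le1 le2|//].
- by rewrite abs0.
- by apply: le_trans (abs_add_le _ _) (lerD le1 le2).
Qed.

Lemma abs_eq0_lt x : (forall e, 0 < e -> v x < e) -> x = 0.
Proof.
move=> lt_e; apply: abs_eq0; apply/eqP; rewrite eq_le abs_ge0 andbT leNgt.
by apply/negP => /lt_e; rewrite ltxx.
Qed.

Lemma abs_cvgP u l : abs_cvg v u l <->
  forall e, 0 < e -> exists N, forall n, (N <= n)%N -> v (u n - l) < e.
Proof.
split=> [cvg_u e e_gt0|lt_e].
  have /cvgrPdist_lt/(_ e e_gt0)[N _ ltN] := cvg_u; exists N => n /ltN /=.
  by rewrite sub0r normrN ger0_norm ?abs_ge0.
apply/cvgrPdist_lt => e /lt_e[N ltN]; exists N => // n /ltN /=.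
by rewrite sub0r normrN ger0_norm ?abs_ge0.
Qed.

Lemma abs_cvg_unique u l l' : abs_cvg v u l -> abs_cvg v u l' -> l = l'.
Proof.
move=> /abs_cvgP cvg_l /abs_cvgP cvg_l'; apply: subr0_eq.
apply: abs_eq0_lt => e e_gt0.
have [N ltN] := cvg_l e e_gt0; have [N' ltN'] := cvg_l' e e_gt0.
have -> : l - l' = (l - u (maxn N N')) + (u (maxn N N') - l').
  by rewrite subrKA.
apply: abs_add_lt; last by rewrite ltN' ?leq_maxr.
by rewrite abs_distC ltN ?leq_maxl.
Qed.

End AbsoluteValue.

(** * Finite-dimensional subspaces over a complete field *)

Section FiniteDimension.
Context {R : realType} {F K : fieldType} {vF : F -> R} {vK : K -> R}.
Context {i : {rmorphism F -> K}}.
Hypotheses (vK_abs : absolute_value vK) (vK_i : forall x, vK (i x) = vF x).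
Hypothesis F_complete : forall u, abs_cauchy vF u -> exists l, abs_cvg vF u l.

(** Families are indexed by all of [nat], and truncated at [n], so that
    induction on the dimension needs no change of index type. *)
Definition lincomb n (b : nat -> K) (c : nat -> F) : K :=
  \sum_(j < n) i (c j) * b j.

Lemma lincombB n b c c' :
  lincomb n b (fun j => c j - c' j) = lincomb n b c - lincomb n b c'.
Proof.
by rewrite /lincomb -sumrB; apply: eq_bigr => j _; rewrite rmorphB mulrBl.
Qed.

Lemma lincombZ n b c k :
  lincomb n b (fun j => k * c j) = i k * lincomb n b c.
Proof.
by rewrite /lincomb mulr_sumr; apply: eq_bigr => j _; rewrite rmorphM mulrA.
Qed.

Definition coord_bound n b (M : R) := forall c j, (j < n)%N ->
  vF (c j) <= M * vK (lincomb n b c).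

Lemma vF_abs : absolute_value vF.
Proof.
have [v_ge0 v_eq0 vM vD] := vK_abs.
split=> [x|x|x y|x y]; rewrite -!vK_i ?rmorphM ?rmorphD //.
rewrite v_eq0; split=> [/eqP|->]; last by rewrite rmorph0.
by rewrite fmorph_eq0 => /eqP.
Qed.

(** If [y] is approximated by combinations with coefficients [c k], the bound
    makes each coordinate of [c k] a Cauchy sequence; the combination of the
    limits equals [y]. *)
Lemma span_closed n b M y : 0 < M -> coord_bound n b M ->
  (forall e, 0 < e -> exists c, vK (y - lincomb n b c) < e) ->
  exists c, y = lincomb n b c.
Proof.
move=> M_gt0 leM approx_y.
have inv_gt0 k : 0 < k.+1%:R^-1 :> R by rewrite invr_gt0.
have [c lt_c] := choice (fun k => approx_y _ (inv_gt0 k)).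
have small_inv e : 0 < e ->
    exists N, forall k, (N <= k)%N -> k.+1%:R^-1 < e :> R.
  move=> e_gt0; exists (Num.bound e^-1) => k lekN.
  have einv_ge0 : 0 <= e^-1 by rewrite invr_ge0 ltW.
  rewrite invf_plt ?posrE //; have := archi_boundP einv_ge0.
  by move=> /lt_le_trans->//; rewrite ler_nat ltnW.
have cauchy_c j : (j < n)%N -> abs_cauchy vF (fun k => c k j).
  move=> ltjn e e_gt0; have [N ltN] := small_inv _ (divr_gt0 e_gt0 M_gt0).
  exists N => k k' /ltN ltk /ltN ltk'.
  have /le_lt_trans -> // := leM (fun j => c k j - c k' j) j ltjn.
  rewrite mulrC -ltr_pdivlMr // lincombB.
  rewrite (_ : _ - _ = (y - lincomb n b (c k')) - (y - lincomb n b (c k))).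
    apply: (abs_add_lt vK_abs); rewrite ?(absN vK_abs).
      by apply: lt_trans (lt_c _) _.
    by apply: lt_trans (lt_c _) _.
  by rewrite opprB [RHS]addrC subrKA.
have [l cvg_l] : exists l, forall j, (j < n)%N ->
    abs_cvg vF (fun k => c k j) (l j).
  suff /choice[l lP] : forall j, exists l,
      (j < n)%N -> abs_cvg vF (fun k => c k j) l by exists l.
  move=> j; have [/cauchy_c/F_complete[l cvg_l]|] := ltnP j n.
    by exists l.
  by exists 0.
exists l; apply: subr0_eq; apply: (abs_eq0_lt vK_abs) => e e_gt0.
have cvg_term j : (j < n)%N ->
    exists N, forall k, (N <= k)%N -> vK (i (c k j - l j) * b j) < e.
  move=> /cvg_l/(abs_cvgP vF_abs) cvg_j.
  (* [b j] may be 0, so the division is by its absolute value plus 1 *)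
  have vb1_gt0 : 0 < vK (b j) + 1 by rewrite ltr_wpDl ?abs_ge0.
  have [N ltN] := cvg_j _ (divr_gt0 e_gt0 vb1_gt0); exists N => k /ltN.
  rewrite ltr_pdivlMr // (absM vK_abs) vK_i; apply: le_lt_trans.
  by rewrite ler_wpM2l ?lerDl // -vK_i (abs_ge0 vK_abs).
have {cvg_term} [N ltN] : exists N, forall j, (j < n)%N ->
    forall k, (N <= k)%N -> vK (i (c k j - l j) * b j) < e.
  have /choice[N ltN] : forall j, exists N, (j < n)%N ->
      forall k, (N <= k)%N -> vK (i (c k j - l j) * b j) < e.
    move=> j; have [/cvg_term[N]|] := ltnP j n; last by exists 0.
    by exists N.
  exists (\max_(j < n) N j)%N => j ltjn k lek; apply: ltN => //.
  by apply: leq_trans lek; apply: (leq_bigmax (Ordinal ltjn)).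
have [N' ltN'] := small_inv _ e_gt0; pose k := maxn N N'.
have -> : y - lincomb n b l =
    (y - lincomb n b (c k)) + lincomb n b (fun j => c k j - l j).
  by rewrite lincombB subrKA.
apply: (abs_add_lt vK_abs).
  by apply: lt_trans (lt_c k) _; rewrite ltN' ?leq_maxr.
apply: (abs_sum_lt vK_abs _ (fun j => i (c k j - l j) * b j)) => // j ltjn.
by rewrite ltN ?leq_maxl.
Qed.

(** Induction on the dimension: the span of the first [n] vectors is closed by
    [span_closed], so [b n], which lies outside of it, stays at a distance at
    least [e > 0] from it. This bounds the last coordinate by [e^-1] times the
    norm, and the induction hypothesis bounds the others after the last term
    has been subtracted. *)
Lemma free_coord_bound n b :
  (forall c, lincomb n b c = 0 -> forall j, (j < n)%N -> c j = 0) ->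
  exists2 M, 0 < M & coord_bound n b M.
Proof.
elim: n => [|n IHn] free_b; first by exists 1.
have lincombS c : lincomb n.+1 b c = lincomb n b c + i (c n) * b n.
  by rewrite /lincomb big_ord_recr.
pose ext (c : nat -> F) x j := if (j < n)%N then c j else x.
have lincomb_ext c x : lincomb n.+1 b (ext c x) = lincomb n b c + i x * b n.
  rewrite lincombS {2}/ext ltnn; congr (_ + _).
  by apply: eq_bigr => j _; rewrite /ext ltn_ord.
have [|M M_gt0 leM] := IHn.
  move=> c c_eq0 j ltjn.
  have := free_b (ext c 0); rewrite lincomb_ext c_eq0 rmorph0 mul0r addr0.
  by move=> /(_ erefl j (ltnW ltjn)); rewrite /ext ltjn.
have [e e_gt0 lee] : exists2 e, 0 < e & forall c, e <= vK (b n - lincomb n b c).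
  apply: contrapT => no_gap.
  have [e e_gt0|c bE] := span_closed n b M (b n) M_gt0 leM.
    apply: contrapT => no_c; apply: no_gap; exists e => // c.
    by rewrite leNgt; apply/negP => ltce; apply: no_c; exists c.
  have := free_b (ext c (-1)); rewrite lincomb_ext rmorphN1 mulN1r -bE subrr.
  move=> /(_ erefl n (ltnSn n)) /eqP; rewrite /ext ltnn oppr_eq0.
  by rewrite oner_eq0.
have vb_ge0 := abs_ge0 vK_abs (b n).
have M_ge0 := ltW M_gt0; have einv_gt0 : 0 < e^-1 by rewrite invr_gt0.
have einv_ge0 := ltW einv_gt0.
have rest_ge0 : 0 <= M * (1 + e^-1 * vK (b n)).
  by rewrite mulr_ge0 ?addr_ge0 ?mulr_ge0.
exists (e^-1 + M * (1 + e^-1 * vK (b n))) => [|c j].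
  by rewrite ltr_pwDl.
set x := lincomb n.+1 b c.
have vx_ge0 : 0 <= vK x by apply: abs_ge0.
have le_last : vF (c n) <= e^-1 * vK x.
  have [->|cn_neq0] := eqVneq (c n) 0.
    by rewrite (abs0 vF_abs) mulr_ge0.
  rewrite mulrC ler_pdivlMr //.
  have -> : x = i (c n) * (b n - lincomb n b (fun j => - (c n)^-1 * c j)).
    rewrite /x lincombS lincombZ rmorphN mulNr opprK mulrDr mulrA -rmorphM.
    by rewrite divff // rmorph1 mul1r addrC.
  by rewrite (absM vK_abs) vK_i ler_wpM2l // (abs_ge0 vF_abs).
rewrite ltnS leq_eqVlt => /predU1P[->|ltjn]; rewrite mulrDl.
  by rewrite (le_trans le_last) // lerDl mulr_ge0.
apply: le_trans (leM c j ltjn) _; apply: ler_wpDl; first exact: mulr_ge0.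
rewrite -mulrA ler_wpM2l //.
have -> : lincomb n b c = x - i (c n) * b n by rewrite /x lincombS addrK.
apply: le_trans (abs_add_le vK_abs _ _) _.
rewrite (absN vK_abs) (absM vK_abs) vK_i mulrDl mul1r lerD2l mulrAC.
by rewrite ler_wpM2r.
Qed.

(** * Polynomial values at conjugate elements *)

Local Notation ev P x := (map_poly i P).[x].

Lemma horner_lincomb n (P : {poly F}) y : (size P <= n)%N ->
  ev P y = lincomb n (GRing.exp y) (fun j => P`_j).
Proof.
move=> leP; rewrite (@horner_coef_wide _ n) ?size_map_poly //.
by apply: eq_bigr => j _; rewrite coef_map.
Qed.

Lemma horner_poly_lincomb n (c : nat -> F) y :
  ev (\poly_(j < n) c j) y = lincomb n (GRing.exp y) c.
Proof.
rewrite (horner_lincomb n) ?size_poly //.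
by apply: eq_bigr => j _; rewrite coef_poly ltn_ord.
Qed.

Variables (m : {poly F}) (z : K).
Hypothesis m_min : is_min_poly i z m.

Lemma min_poly_size : size m = (size m).-1.+1.
Proof.
by case: m_min => m_monic _ _; rewrite prednK ?size_poly_gt0 ?monic_neq0.
Qed.

Lemma horner_modp_lincomb P y : root (map_poly i m) y ->
  ev P y = lincomb (size m).-1 (GRing.exp y) (fun j => (P %% m)`_j).
Proof.
move=> /rootP my0; rewrite -horner_lincomb; last first.
  by rewrite -ltnS -min_poly_size ltn_modp; case: m_min => /monic_neq0.
rewrite [in LHS](divp_eq P m) rmorphD rmorphM /=.
by rewrite hornerD hornerM my0 mulr0 add0r.
Qed.

(** The powers of [z] below the degree of [m] are independent because no
    nonzero polynomial of smaller degree than [m] vanishes at [z]. *)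
Lemma powers_coord_bound :
  exists2 M, 0 < M & coord_bound (size m).-1 (GRing.exp z) M.
Proof.
apply: free_coord_bound => c c_eq0 j ltj.
have [_ _ min_m] := m_min.
have [q_eq0|/min_m min_q] := eqVneq (\poly_(k < (size m).-1) c k) 0.
  by have := coef_poly (size m).-1 c j; rewrite ltj q_eq0 coef0.
have := min_q; rewrite leqNgt min_poly_size ltnS size_poly.
by move=> /(_ _)/negP[] //; apply/rootP; rewrite horner_poly_lincomb.
Qed.

(** [P(z)] and [P(z')] are the combinations of the powers of [z] and of [z']
    with the same coefficients, those of [P %% m], and the coordinate bound for
    the powers of [z] controls these coefficients by [P(z)]. *)
Lemma conjugate_abs_horner_le z' : root (map_poly i m) z' ->
  exists2 C, 0 < C & forall P, vK (ev P z') <= C * vK (ev P z).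
Proof.
move=> mz'; have [M M_gt0 leM] := powers_coord_bound.
have [_ mz _] := m_min; have v_ge0 := abs_ge0 vK_abs.
exists (1 + \sum_(j < (size m).-1) M * vK (z' ^+ j)) => [|P].
  by rewrite ltr_pwDl // sumr_ge0 // => j _; rewrite mulr_ge0 // ltW.
rewrite mulrDl mul1r ler_wpDl //.
rewrite (horner_modp_lincomb P z') // (horner_modp_lincomb P z) //.
apply: le_trans (abs_sum_le vK_abs _ (fun j => i (P %% m)`_j * z' ^+ j)) _.
rewrite mulr_suml; apply: ler_sum => j _.
rewrite (absM vK_abs) vK_i mulrAC ler_wpM2r //.
exact: leM.
Qed.

(** Modulo [m], the [P n] range over a finite-dimensional space, whose image
    in [K] is closed. *)
Lemma adjoin_closed P y : abs_cvg vK (fun n => ev (P n) z) y ->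
  exists Q, y = ev Q z.
Proof.
move=> /(abs_cvgP vK_abs) cvg_y; have [M M_gt0 leM] := powers_coord_bound.
have [_ mz _] := m_min.
have [e e_gt0|c ->] := span_closed _ _ _ y M_gt0 leM.
  have [N /(_ N (leqnn N)) ltN] := cvg_y _ e_gt0.
  exists (fun j => (P N %% m)`_j).
  by rewrite (abs_distC vK_abs) -horner_modp_lincomb.
by exists (\poly_(j < (size m).-1) c j); rewrite horner_poly_lincomb.
Qed.

(** Were |z'| > |z|, the powers of |z|/|z'| would tend to 0, whereas
    [conjugate_abs_horner_le] at 'X^n bounds them below by [C^-1]. *)
Lemma conjugate_abs_le z' : root (map_poly i m) z' -> vK z' <= vK z.
Proof.
move=> /conjugate_abs_horner_le[C C_gt0 leC]; rewrite leNgt; apply/negP => lt_z.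
have z_ge0 := abs_ge0 vK_abs z; have z'_gt0 := le_lt_trans z_ge0 lt_z.
have r_lt1 : vK z / vK z' < 1 by rewrite ltr_pdivrMr // mul1r.
have [|N /(_ N (leqnn N))] := geometric_lt _ C 1 _ r_lt1 ltr01.
  by rewrite divr_ge0 // ltW.
rewrite expr_div_n mulrA ltr_pdivrMr ?exprn_gt0 // mul1r ltNge => /negP[].
by have := leC 'X^N; rewrite map_polyXn !hornerXn !(absX vK_abs).
Qed.

(** Instead of a divisibility argument: [P(z')] is bounded by a multiple of
    |P(z)| = 0. *)
Lemma conjugate_horner_root P z' : root (map_poly i m) z' ->
  ev P z = 0 -> ev P z' = 0.
Proof.
move=> /conjugate_abs_horner_le[C _ leC] Pz0; apply: (abs_eq0 vK_abs).
apply/eqP; rewrite eq_le (abs_ge0 vK_abs) andbT.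
by apply: le_trans (leC P) _; rewrite Pz0 (abs0 vK_abs) mulr0.
Qed.

Lemma conjugate_horner_cvg P Q z' : root (map_poly i m) z' ->
  abs_cvg vK (fun n => ev (P n) z) (ev Q z) ->
  abs_cvg vK (fun n => ev (P n) z') (ev Q z').
Proof.
move=> /conjugate_abs_horner_le[C C_gt0 leC] /(abs_cvgP vK_abs) cvg_P.
apply/(abs_cvgP vK_abs) => e e_gt0.
have [N ltN] := cvg_P _ (divr_gt0 e_gt0 C_gt0); exists N => n /ltN.
rewrite ltr_pdivlMr // mulrC; apply: le_lt_trans.
by have := leC (P n - Q); rewrite rmorphB /= !hornerE.
Qed.

End FiniteDimension.

(** * Ultrametric power series *)

Section PowerSeries.
Context {R : realType} {K : fieldType} {v : K -> R}.
Hypothesis v_abs : absolute_value v.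
Hypothesis K_complete : forall u, abs_cauchy v u -> exists l, abs_cvg v u l.

(** The terms at [y] tend to 0, so those at [z] are eventually smaller than the
    powers of |z|/|y|; a series whose terms tend to 0 is Cauchy, by the
    ultrametric inequality. *)
Lemma abs_cvg_series_inside (a : nat -> K) y w z :
  abs_cvg v (series (fun n => a n * y ^+ n)) w -> v z < v y ->
  exists l, abs_cvg v (series (fun n => a n * z ^+ n)) l.
Proof.
move=> /(abs_cvgP v_abs) cvg_w lt_zy; apply: K_complete => e e_gt0.
have z_ge0 := abs_ge0 v_abs z; have y_gt0 := le_lt_trans z_ge0 lt_zy.
have [N ltN] := cvg_w 1 ltr01.
have term_lt1 n : (N <= n)%N -> v (a n * y ^+ n) < 1.
  move=> leNn.
  have -> : a n * y ^+ n = (series (fun n => a n * y ^+ n) n.+1 - w)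
     - (series (fun n => a n * y ^+ n) n - w).
    by rewrite seriesSr (addrAC (series _ n)) [RHS]addrC addKr.
  by apply: (abs_add_lt v_abs); rewrite ?(absN v_abs) ltN // ltnW.
have r_lt1 : v z / v y < 1 by rewrite ltr_pdivrMr // mul1r.
have [|N' ltN'] := geometric_lt _ 1 e _ r_lt1 e_gt0.
  by rewrite divr_ge0 // ltW.
have term_lt n : (maxn N N' <= n)%N -> v (a n * z ^+ n) < e.
  rewrite geq_max => /andP[/term_lt1 lt1 /ltN'].
  rewrite mul1r; apply: le_lt_trans.
  move: lt1; rewrite !(absM v_abs) !(absX v_abs) expr_div_n => /ltW lt1.
  rewrite ler_pdivlMr ?exprn_gt0 // mulrAC ler_piMl ?exprn_ge0 //.
suff sub_lt n k : (maxn N N' <= n)%N ->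
    v (series (fun n => a n * z ^+ n) (n + k)%N -
       series (fun n => a n * z ^+ n) n) < e.
  exists (maxn N N') => n n' len len'.
  have [le|/ltnW le] := leqP n n'.
    by rewrite (abs_distC v_abs) -(subnKC le) sub_lt.
  by rewrite -(subnKC le) sub_lt.
move=> len; elim: k => [|k IHk]; first by rewrite addn0 subrr (abs0 v_abs).
rewrite addnS seriesSr (addrAC (series _ _)); apply: (abs_add_lt v_abs) => //.
by rewrite term_lt // (leq_trans len) ?leq_addr.
Qed.

End PowerSeries.

(** * Power series with rational coefficients on Cp *)

Section PadicSeries.
Context {R : realType} {p : nat} {C : padic_complex R p}.

Lemma Cp_absolute_value : absolute_value (@Cp_abs R p C).
Proof. by case: (Cp_completion C). Qed.

Lemma Cp_abs_of_Qp x : Cp_abs (Cp_of_Qp C x) = Qp_abs x.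
Proof.
by case: (Cp_completion C) => _ CpE _ _; rewrite /= CpE Qpbar_abs_extends.
Qed.

Lemma Qp_complete u :
  abs_cauchy (@Qp_abs R p C) u -> exists l, abs_cvg (@Qp_abs R p C) u l.
Proof. by case: (Qp_completion C) => _ _ /(_ u). Qed.

Lemma pseriesE (a : nat -> rat) (z w : C) : pseries_cvg a z w ->
  Defs.pseries a z = w.
Proof.
move=> cvg_w; apply: (abs_cvg_unique Cp_absolute_value _ _ _ _ cvg_w).
by apply: (xgetPex (0 : C)); exists w.
Qed.

Lemma pseries_cvg_in_disc (a : nat -> rat) (z : C) :
  Defs.ball0 (radius_of_convergence C a) z -> exists w, pseries_cvg a z w.
Proof.
have [_ _ Cp_complete _] := Cp_completion C.
move=> /ereal_sup_gt[_ [y [w cvg_w] <-]]; rewrite lte_fin.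
exact: (abs_cvg_series_inside Cp_absolute_value Cp_complete _ _ w).
Qed.

Lemma partial_sum_horner (a : nat -> rat) :
  let P n := \poly_(k < n) Qp_of_rat C (a k) in
  forall z, series (fun n => Cp_of_rat C (a n) * z ^+ n) =
            (fun n => (map_poly (Cp_of_Qp C) (P n)).[z]).
Proof.
move=> P z; apply/funext => n.
by rewrite horner_poly_lincomb /series /= big_mkord.
Qed.

(** This turns the fact that a value of [Q] is a root of a rational polynomial
    into the vanishing of one polynomial over Qp at the point itself. *)
Lemma horner_comp_rat (q : {poly rat}) (Q : {poly Qp C}) (z : C) :
  (map_poly (Cp_of_rat C) q).[(map_poly (Cp_of_Qp C) Q).[z]] =
  (map_poly (Cp_of_Qp C) (map_poly (@Qp_of_rat R p C) q \Po Q)).[z].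
Proof. by rewrite map_comp_poly horner_comp -map_poly_comp. Qed.

Lemma Qbar_conjugate_value (m Q : {poly Qp C}) (z z' : C) :
  is_min_poly (Cp_of_Qp C) z m -> root (map_poly (Cp_of_Qp C) m) z' ->
  Qbar (map_poly (Cp_of_Qp C) Q).[z] -> Qbar (map_poly (Cp_of_Qp C) Q).[z'].
Proof.
move=> m_min mz' [q q_neq0 /rootP]; rewrite horner_comp_rat => qQz0.
exists q => //; apply/rootP; rewrite horner_comp_rat.
exact: (conjugate_horner_root Cp_absolute_value Cp_abs_of_Qp Qp_complete
  _ _ m_min _ _ mz').
Qed.

End PadicSeries.

Theorem proposition1 (p : nat) (p_prime : prime p)
  (R : realType) (C : padic_complex R p)
  (rho : \bar R) (rho_gt0 : (0 < rho)%E)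
  (a : nat -> rat) (a_radius : radius_of_convergence C a = rho)
  (alpha : C) (alpha_exc : exceptional_set a rho alpha)
  (d : nat) (d_degree : ext_degree (Cp_of_Qp C) (adjoin (Cp_of_Qp C) alpha) d)
  (d_gt1 : (1 < d)%N)
  (alpha' : C) (alpha'_alg : Qbar alpha')
  (alpha'_conj : conjugate_over (Cp_of_Qp C) alpha alpha') :
  exceptional_set a rho alpha'.
Proof.
have [alpha_ball _ falpha_alg] := alpha_exc.
have [m m_min m_alpha'] := alpha'_conj.
have [w cvg_w] : exists w, pseries_cvg a alpha w.
  by apply: pseries_cvg_in_disc; rewrite a_radius.
have falpha := pseriesE _ _ _ cvg_w.
move: cvg_w; rewrite /pseries_cvg partial_sum_horner => cvg_w.
have [Q wE] := adjoin_closed Cp_absolute_value Cp_abs_of_Qp Qp_complete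
  _ _ m_min _ _ cvg_w.
rewrite wE in cvg_w.
have falpha' : Defs.pseries a alpha' = (map_poly (Cp_of_Qp C) Q).[alpha'].
  apply: pseriesE; rewrite /pseries_cvg partial_sum_horner.
  exact: (conjugate_horner_cvg Cp_absolute_value Cp_abs_of_Qp Qp_complete
    _ _ m_min _ _ _ m_alpha').
split=> //; last first.
  rewrite falpha'; apply: (Qbar_conjugate_value _ _ _ _ m_min m_alpha').
  by rewrite -wE -falpha.
apply: le_lt_trans alpha_ball; rewrite lee_fin.
exact: (conjugate_abs_le Cp_absolute_value Cp_abs_of_Qp Qp_complete
  _ _ m_min _ m_alpha').
Qed.
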